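(* Let $G$ be a finite DAG with a weight matrix $C$ supported on $G$, and let $\overline{G}$ be the transitive closure of $G$. There exists a weight matrix $\overline{C}$ supported on $\overline{G}$ such that $\mathcal{M}_*(\overline{G},\overline{C})=\mathcal{M}_*(G,C)$.
   Context: Let $G=(V,E)$ be a finite DAG. A weight matrix supported on $G$ is a $V\times V$ matrix $C=(c_{ij})$ with $c_{ij}\in\mathbb{R}$ if $i\to j\in E$ and $c_{ij}=-\infty$ otherwise. For distinct $i,j\in V$, $P(i,j)$ is the set of directed paths from $i$ to $j$ in $G$, and the weight of a path $\pi$ is $\omega_C(\pi)=\sum_{e\in\pi}c_e$. A path in $P(i,j)$ is critical (for $(G,C)$) if its weight is maximal among all paths in $P(i,j)$; critical paths need not be unique. The transitive closure $\overline G$ is the DAG on $V$ with an edge $i\to j$ whenever $P(i,j)\neq\emptyset$. For $L\subseteq V$, the critical DAG $G^*_{C,L}$ is the DAG on $V$ with an edge $i\to j$ ($i\neq j$) if and only if $P(i,j)\neq\emptyset$ and no critical path from $i$ to $j$ in $(G,C)$ has an interior node in $L$. Distinct $i,j\in V\setminus L$ are $C^*$-connected given $L$ if $G^*_{C,L}$ contains, up to exchanging $i$ and $j$, a path of one of the forms (a) $i\to j$; (b) $i\leftarrow p\to j$; (c) $i\to \ell\leftarrow j$; (d) $i\leftarrow p\to\ell\leftarrow j$; (e) $i\leftarrow p\to\ell\leftarrow q\to j$, with $\ell\in L$ and $p,q\notin L$. Otherwise they are $C^*$-separated given $L$. For pairwise disjoint $I,J,L\subseteq V$, $I$ and $J$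 are $C^*$-separated given $L$ if every $i\in I$ and $j\in J$ are $C^*$-separated given $L$. The maxoid $\mathcal{M}_*(G,C)$ is the set of all triples (CI statements) $[I\perp\!\!\!\perp J\mid L]$ with $I,J,L$ pairwise disjoint such that $I$ and $J$ are $C^*$-separated given $L$ in $(G,C)$. *)

(* Defs.v *)
From mathcomp Require Import all_boot all_order all_algebra.
From mathcomp Require Import all_classical all_reals.

Set Implicit Arguments.
Unset Strict Implicit.
Unset Printing Implicit Defensive.

Import Order.TTheory GRing.Theory Num.Theory.

Section Maxoid.

Context {R : realType} {V : finType}.
Implicit Types (G : rel V) (C : V -> V -> \bar R) (L : {set V}).

(* [cycle G [:: x]] is [G x x], so self-loops are excluded as well. *)
Definition is_dag G : Prop := forall c : seq V, cycle G c -> c = [::].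

Definition supported G C : Prop :=
  forall i j, (G i j -> C i j \is a fin_num) /\ (~~ G i j -> C i j = -oo%E).

(* The path i -> x_1 -> ... -> x_n = j is encoded by its start i and the
   sequence [:: x_1; ...; x_n]. In a DAG the nodes of such a sequence are
   automatically distinct; only the case i != j is used below. *)
Definition paths G i j : pred (seq V) :=
  [pred p | path G i p & last i p == j].

Definition weight C i (p : seq V) : \bar R :=
  (\sum_(c <- pairmap C i p) c)%E.

(* [belast i p] drops the end point and [behead] then drops i. *)
Definition interior_nodes (i : V) (p : seq V) : seq V := behead (belast i p).

Definition critical G C i j (p : seq V) : Prop :=
  p \in paths G i j /\
  forall q, q \in paths G i j -> (weight C i q <= weight C i p)%E.

(* [connect G] is the reflexive transitive closure, so for i != j
   [connect G i j] says that there is a directed path from i to j. *)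
Definition trans_closure G : rel V := [rel i j | (i != j) && connect G i j].

Definition critical_dag G C L (i j : V) : Prop :=
  [/\ i != j, connect G i j &
      forall p, critical G C i j p ->
        forall k, k \in interior_nodes i p -> k \notin L].

(* The five forms i -> j, i <- p -> j, i -> l <- j, i <- p -> l <- j and
   i <- p -> l <- q -> j, for a directed graph with edges [E].
   Distinctness of the nodes need not be required: for p = q the last form is
   the second one, and any other coincidence yields an edge between i and j. *)
Definition cstar_form (E : V -> V -> Prop) L (i j : V) : Prop :=
  [\/ E i j,
      exists2 p, p \notin L & E p i /\ E p j,
      exists2 l, l \in L & E i l /\ E j l |
      (exists p l, [/\ p \notin L, l \in L & [/\ E p i, E p l & E j l]]) \/
      (exists p l q, [/\ p \notin L, l \in L, q \notin L &
                         [/\ E p i, E p l, E q l & E q j]])].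

Definition cstar_connected G C L (i j : V) : Prop :=
  cstar_form (critical_dag G C L) L i j \/
  cstar_form (critical_dag G C L) L j i.

Definition cstar_separated G C L (A B : {set V}) : Prop :=
  forall i j, i \in A -> j \in B -> ~ cstar_connected G C L i j.

(* The triple (A, B, L) stands for the CI statement [A _||_ B | L]. *)
Definition ci_statement : Type := {set V} * {set V} * {set V}.

Definition holds_in_maxoid G C (t : ci_statement) : Prop :=
  let: (A, B, L) := t in
  [/\ [disjoint A & B], [disjoint A & L], [disjoint B & L] &
      cstar_separated G C L A B].

Definition maxoid G C : set ci_statement :=
  [set t | holds_in_maxoid G C t]%classic.

End Maxoid.

(* Main.v *)
(** Keep the weights on the edges of [G] and give every further edge i -> j of
    the transitive closure the weight of some path from i to j in [G], minus 1.
    Replacing the new edges of a path by these paths of [G] strictly increases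
    its weight, so the critical paths, and with them the critical DAGs and the
    maxoid, are unchanged. *)
Require Import Defs.
From mathcomp Require Import all_boot all_order all_algebra.
From mathcomp Require Import all_classical all_reals.

Set Implicit Arguments.
Unset Strict Implicit.
Unset Printing Implicit Defensive.

Import Order.TTheory GRing.Theory Num.Theory.

Section Weight.
Context {R : realType} {V : finType}.
Implicit Types (G : rel V) (C : V -> V -> \bar R).

Lemma weight_cons C i x p :
  weight C i (x :: p) = (C i x + weight C x p)%E.
Proof. by rewrite /weight /= big_cons. Qed.

Lemma weight_cat C i p q :
  weight C i (p ++ q) = (weight C i p + weight C (last i p) q)%E.
Proof. by rewrite /weight pairmap_cat big_cat. Qed.

Lemma weight_fin_num G C i p :
  supported G C -> path G i p -> weight C i p \is a fin_num.
Proof.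
move=> suppC; elim: p i => [|x p IHp] i /=; first by rewrite /weight big_nil.
case/andP=> Gix Gp; rewrite weight_cons fin_numD IHp // andbT.
by have [+ _] := suppC i x; apply.
Qed.

End Weight.

Section Closure.
Context {R : realType} {V : finType} (G : rel V) (C : V -> V -> \bar R).
Hypotheses (dagG : is_dag G) (suppC : supported G C).

(** The default [[::]] is returned only when no path exists; [closure_weight] never reads it in that
    case. *)
Definition some_path i j : seq V :=
  xget [::] [set p | p \in paths G i j]%classic.

Lemma some_pathP i j : connect G i j -> some_path i j \in paths G i j.
Proof.
case/connectP=> p Gp jE.
by apply: (@xgetPex _ [::] [set p | p \in paths G i j]%classic); exists p;
  rewrite /= inE Gp jE /=.
Qed.

Definition closure_weight (i j : V) : \bar R :=
  if G i j then C i j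
  else if trans_closure G i j then (weight C i (some_path i j) - 1)%E
  else -oo%E.

(** Acyclicity enters here: [trans_closure] omits loops, and a loop of [G] at [i] would be the cycle
    [[:: i]]. *)
Lemma sub_trans_closure : subrel G (trans_closure G).
Proof.
move=> i j Gij; rewrite /trans_closure /= connect1 // andbT.
by apply/eqP=> eij; have := dagG (c := [:: i]); rewrite /= {2}eij Gij => /(_ isT).
Qed.

Lemma connect_trans_closure : connect (trans_closure G) =2 connect G.
Proof.
move=> i j; apply/idP/idP; apply: connect_sub => x y; first by case/andP.
by move/sub_trans_closure/connect1.
Qed.

Lemma weight_some_path_fin_num i j :
  connect G i j -> weight C i (some_path i j) \is a fin_num.
Proof. by move/some_pathP/andP=> [/(weight_fin_num suppC)]. Qed.

Lemma supported_closure_weight : supported (trans_closure G) closure_weight.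
Proof.
move=> i j; rewrite /closure_weight; split=> Tij; last first.
  by rewrite (contraNF (@sub_trans_closure i j) Tij) (negPf Tij).
case: ifP => Gij; first by have [+ _] := suppC i j; apply.
by rewrite Tij fin_numB weight_some_path_fin_num //; case/andP: Tij.
Qed.

Lemma weight_closure_weight i p :
  path G i p -> weight closure_weight i p = weight C i p.
Proof.
elim: p i => [|x p IHp] i /=; first by rewrite /weight !big_nil.
by case/andP=> Gix Gp; rewrite !weight_cons IHp // /closure_weight Gix.
Qed.

(** Induction along the path: edges of [G] are kept, and a new edge gives way to its chosen path,
    which weighs exactly 1 more. *)
Lemma closure_path_dominated i p :
  path (trans_closure G) i p -> ~~ path G i p ->
  exists2 q, q \in paths G i (last i p) &
             (weight closure_weight i p < weight C i q)%E.
Proof.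
elim: p i => [|x p IHp] i //= /andP[Tix Tp].
have [Gix /= /(IHp _ Tp)[q /andP[Gq lastq] ltq]|nGix _] := boolP (G i x).
  exists (x :: q); first by rewrite inE /= Gix Gq.
  rewrite !weight_cons {1}/closure_weight Gix lteD2lE //.
  by have [+ _] := suppC i x; apply.
(* The edge into [x] is new and already gives strictness. The tail may lie entirely in [G], so only
   a weak inequality is available for it. *)
have [q /andP[Gq lastq] leq] : exists2 q, q \in paths G x (last x p) &
    (weight closure_weight x p <= weight C x q)%E.
  have [Gp|/(IHp _ Tp)[q Gq /ltW]] := boolP (path G x p); last by exists q.
  by exists p; rewrite ?inE ?Gp ?eqxx // weight_closure_weight.
have cix : connect G i x by case/andP: Tix.
have /andP[Gr /eqP lastr] := some_pathP cix.
exists (some_path i x ++ q); first by rewrite inE /= cat_path last_cat lastr Gr Gq.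
(* Strictness survives the addition in [\bar R] because the tail has finite weight. *)
rewrite weight_cons weight_cat lastr lte_leD //.
  exact: weight_fin_num supported_closure_weight Tp.
rewrite /closure_weight (negPf nGix) Tix.
by rewrite -(fineK (weight_some_path_fin_num cix)) lte_fin ltrBlDr ltrDl ltr01.
Qed.

Lemma critical_trans_closure i j p :
  critical (trans_closure G) closure_weight i j p <-> critical G C i j p.
Proof.
have pathsS q : q \in paths G i j -> q \in paths (trans_closure G) i j.
  by case/andP=> Gq lastq; rewrite inE /= lastq (sub_path sub_trans_closure).
split=> -[ijp maxp].
  have /andP[Tp /eqP lastp] := ijp.
  have Gp : path G i p.
    (* If [p] used a new edge, the heavier path [q] of [G] would also compete in the closure,
       against the maximality of [p]. *)
    apply: contraT => /(closure_path_dominated Tp)[q]; rewrite lastp => ijq.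
    have /andP[Gq _] := ijq.
    by rewrite -weight_closure_weight // ltNge maxp // pathsS.
  split=> [|q ijq]; first by rewrite inE /= Gp lastp /=.
  have /andP[Gq _] := ijq.
  by rewrite -!weight_closure_weight // maxp // pathsS.
have /andP[Gp _] := ijp; split=> [|q /andP[Tq /eqP lastq]]; first exact: pathsS.
rewrite (weight_closure_weight Gp).
(* A competitor with a new edge lies below some path [r] of [G], hence below [p]. *)
have [Gq|/(closure_path_dominated Tq)[r]] := boolP (path G i q).
  by rewrite weight_closure_weight // maxp // inE /= Gq lastq /=.
by rewrite lastq => /maxp ler /ltW /le_trans; apply.
Qed.

Lemma critical_dag_trans_closure :
  critical_dag (trans_closure G) closure_weight = critical_dag G C.
Proof.
apply/funext=> L; apply/funext=> i; apply/funext=> j; apply/propext.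
rewrite /critical_dag connect_trans_closure.
by split=> -[neq_ij cij critL]; split=> // p /critical_trans_closure /critL.
Qed.

End Closure.

Theorem lemma2p5 (R : realType) (V : finType) (G : rel V)
    (C : V -> V -> \bar R) (dagG : is_dag G) (suppC : supported G C) :
  exists Cbar : V -> V -> \bar R,
    supported (trans_closure G) Cbar /\
    maxoid (trans_closure G) Cbar = maxoid G C.
Proof.
exists (closure_weight G C); split; first exact: supported_closure_weight.
(* The graph and its weights enter the maxoid only through [critical_dag]. *)
rewrite /maxoid /holds_in_maxoid /cstar_separated /cstar_connected.
by rewrite critical_dag_trans_closure.
Qed.
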